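(* Assume that $G$ is Fréchet differentiable with Lipschitz continuous gradient (constant $L_G>0$) and strongly convex with coercivity constant $\alpha_G>0$, and that there is $\alpha_B>0$ with $\|B'\mu\|_X\ge\alpha_B\|\mu\|_Y$ for all $\mu\in Y$. Let $(u^j,p^j;\lambda^j)$, $j\ge0$, be the iterates of the Generalized ADMM (defined in the context), with residuals $R_j$. If $\underline{\tau}\le\tau_{j+1}\le\tau_j\le\overline{\tau}$ for all $j\ge0$, then there exist a sequence $(\gamma_j)_{j\in\mathbb{N}}\subset(0,1)$ and $\gamma<1$ with $\gamma_j\le\gamma$ for all $j\ge1$ such that $$R_{j+1}^2\le\gamma_{j+1}R_j^2\qquad\text{for all } j\ge1 .$$
   Context: $X,Y$ are real Hilbert spaces with inner products $(\cdot,\cdot)_X,(\cdot,\cdot)_Y$, identified with their duals. $F:Y\to\mathbb{R}\cup\{+\infty\}$ and $G:X\to\mathbb{R}\cup\{+\infty\}$ are convex, proper and lower semicontinuous, and $B:X\to Y$ is a bounded linear operator, with adjoint $B'$, such that $u\mapsto F(Bu)+G(u)$ is proper and coercive. For $\tau>0$, $$\mathcal{L}_\tau(u,p;\lambda)=F(p)+G(u)+(\lambda,Bu-p)_Y+\frac{\tau}{2}\|Bu-p\|_Y^2 ,$$ and $(u,p;\lambda)\in X\times Y\times Y$ is a saddle point of $\mathcal{L}_\tau$ if $\mathcal{L}_\tau(u,p;\mu)\le\mathcal{L}_\tau(u,p;\lambda)\le\mathcal{L}_\tau(v,q;\lambda)$ for all $(v,q,\mu)\in X\times Y\times Y$. It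 is assumed that a saddle point exists. $\nabla G(v)\in X$ denotes the representative of $G'(v)$: $(\nabla G(v),w)_X=G'(v)[w]$ for all $w\in X$. Lipschitz continuity means $\|\nabla G(v)-\nabla G(v')\|_X\le L_G\|v-v'\|_X$ for all $v,v'\in X$. Strong convexity with coercivity constant $\alpha_G$ means $(\nabla G(v),w-v)_X+G(v)+\alpha_G\|w-v\|_X^2\le G(w)$ for all $v,w\in X$. Generalized ADMM: choose $(u^0,\lambda^0)\in X\times Y$ with $G(u^0)<\infty$, $\overline{\tau}\ge\underline{\tau}>0$, and set $\tau_1=\overline{\tau}$. For $j=1,2,\dots$: compute a minimizer $p^j\in Y$ of $p\mapsto\mathcal{L}_{\tau_j}(u^{j-1},p;\lambda^{j-1})$; compute a minimizer $u^j\in X$ of $u\mapsto\mathcal{L}_{\tau_j}(u,p^j;\lambda^{j-1})$ (minimizers are assumed to exist); set $\lambda^j=\lambda^{j-1}+\tau_j(Bu^j-p^j)$; define the residual $R_j=\bigl(\|\lambda^j-\lambda^{j-1}\|_Y^2+\tau_j^2\|B(u^j-u^{j-1})\|_Y^2\bigr)^{1/2}$; choose $\tau_{j+1}\in[\underline{\tau},\overline{\tau}]$. The iterates are regarded as an infinite sequence (the stopping test is ignored). By convention $\tau_0:=\tau_1$. *)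

(* Defs.v *)
From HB Require Import structures.
From mathcomp Require Import all_boot all_order all_algebra.
From mathcomp Require Import sesquilinear.
From mathcomp Require Import all_classical all_reals all_analysis.

Set Implicit Arguments.
Unset Strict Implicit.
Unset Printing Implicit Defensive.

Import Order.TTheory GRing.Theory Num.Theory.
Import numFieldNormedType.Exports.

Local Open Scope ring_scope.

Section ConvexAnalysis.
Context {R : realType} {V : normedModType R}.
Implicit Types f : V -> \bar R.

(* The value +oo is allowed, -oo is not. *)
Definition eproper f : Prop :=
  (forall v, f v != -oo%E) /\ (exists v, (f v < +oo)%E).

(* For t = 0 or t = 1 this relies on 0 * +oo = 0. *)
Definition econvex f : Prop :=
  forall (v w : V) (t : R), 0 <= t <= 1 ->
    (f (t *: v + (1 - t) *: w)%R <= t%:E * f v + (1 - t)%:E * f w)%E.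

(* f v tends to +oo as `|v| does. *)
Definition coercive f : Prop :=
  forall M : R, exists r : R, forall v, r <= `|v| -> (M%:E <= f v)%E.

(* A differentiable function is in particular finite everywhere; 'd and
   differentiable are those of its real-valued version. *)
Definition frechet_differentiable f : Prop :=
  forall v, f v \is a fin_num /\ differentiable (fine \o f) v.

End ConvexAnalysis.

Section Hilbert.
Context {R : realType}.

(* A real Hilbert space is a complete normed space whose norm is induced by
   an inner product, i.e. a symmetric positive definite bilinear form. *)
Definition induces_norm (V : completeNormedModType R)
    (ip : {dot V for idfun}) : Prop :=
  forall v : V, `|v| ^+ 2 = ip v v.

Context {X Y : completeNormedModType R}.
Context (ipX : {dot X for idfun}) (ipY : {dot Y for idfun}).

Definition bounded_operator (B : X -> Y) : Prop :=
  exists C : R, forall u, `|B u| <= C * `|u|.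

Definition is_adjoint (B : X -> Y) (B' : Y -> X) : Prop :=
  forall u mu, ipX (B' mu) u = ipY mu (B u).

Definition is_gradient (G : X -> \bar R) (gradG : X -> X) : Prop :=
  forall v w, ipX (gradG v) w = 'd (fine \o G) v w.

Definition strongly_convex (G : X -> \bar R) (gradG : X -> X) (alphaG : R) :
    Prop :=
  forall v w,
    ((ipX (gradG v) (w - v))%:E + G v + (alphaG * `|w - v| ^+ 2)%:E <= G w)%E.

Section ADMM.
Context (F : Y -> \bar R) (G : X -> \bar R) (B : X -> Y).

Definition lagrangian (tau : R) (u : X) (p lam : Y) : \bar R :=
  (F p + G u + (ipY lam (B u - p))%:E + (tau / 2 * `|B u - p| ^+ 2)%:E)%E.

Definition saddle_point (tau : R) (u : X) (p lam : Y) : Prop :=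
  forall v q mu,
    (lagrangian tau u p mu <= lagrangian tau u p lam)%E /\
    (lagrangian tau u p lam <= lagrangian tau v q lam)%E.

(* The algorithm produces no p^0: the value p 0 is unconstrained and unused. *)
Record generalized_admm (taumin taumax : R)
    (u : nat -> X) (p lam : nat -> Y) (tau : nat -> R) : Prop := {
  admm_taumin_gt0 : 0 < taumin ;
  admm_taumin_le : taumin <= taumax ;
  admm_init : (G (u 0%N) < +oo)%E ;
  admm_tau0 : tau 0%N = tau 1%N ;
  admm_tau1 : tau 1%N = taumax ;
  admm_p : forall (j : nat) (q : Y),
    (lagrangian (tau j.+1) (u j) (p j.+1) (lam j)
       <= lagrangian (tau j.+1) (u j) q (lam j))%E ;
  admm_u : forall (j : nat) (v : X),
    (lagrangian (tau j.+1) (u j.+1) (p j.+1) (lam j)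
       <= lagrangian (tau j.+1) v (p j.+1) (lam j))%E ;
  admm_lam : forall j : nat,
    lam j.+1 = lam j + tau j.+1 *: (B (u j.+1) - p j.+1) ;
  admm_tau : forall j : nat, (1 <= j)%N -> taumin <= tau j.+1 <= taumax
}.

(* Meaningful for j >= 1 only. *)
Definition residual (u : nat -> X) (lam : nat -> Y) (tau : nat -> R)
    (j : nat) : R :=
  Num.sqrt (`|lam j - lam j.-1| ^+ 2
            + tau j ^+ 2 * `|B (u j - u j.-1)| ^+ 2).

End ADMM.

End Hilbert.

(* Main.v *)
Require Import Defs.
From HB Require Import structures.
From mathcomp Require Import all_boot all_order all_algebra.
From mathcomp Require Import sesquilinear.
From mathcomp Require Import all_classical all_reals all_analysis.
From mathcomp Require Import ring lra.

Set Implicit Arguments.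
Unset Strict Implicit.
Unset Printing Implicit Defensive.

Import Order.TTheory GRing.Theory Num.Theory.
Import numFieldNormedType.Exports.

Local Open Scope ring_scope.

(* Write D, D' for the last two increments of lam, and s, t for
   tau_{j+1} B (u^{j+1} - u^j) and tau_j B (u^j - u^{j-1}).  The optimality
   condition for p^{j+1} puts lam^{j+1} - s in the subdifferential of F at
   p^{j+1}; its monotonicity between the steps j and j+1, together with
   tau_{j+1} <= tau_j, yields |D - s|^2 <= |D'|^2 + |t|^2 = R_j^2.  On the other
   hand |D - s|^2 = R_{j+1}^2 - 2 (D, s), and since B' lam^j = - grad G (u^j),
   strong convexity gives
     - 2 (D, s) >= 4 tau_{j+1} alpha_G |u^{j+1} - u^j|^2.
   Both |D| <= (L_G / alpha_B) |u^{j+1} - u^j| and |s| are controlled by the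
   increment of u, so this is at least kappa R_{j+1}^2 for a fixed kappa > 0,
   and R_{j+1}^2 <= (1 + kappa)^-1 R_j^2. *)

(** * First-order conditions at the minimum of a convex function plus a quadratic *)

Lemma affine_ge0_at0 (R : realFieldType) (a b : R) :
  (forall t, 0 < t <= 1 -> 0 <= a + t * b) -> 0 <= a.
Proof.
move=> h; rewrite leNgt; apply/negP => a_lt0.
have d_gt0 : 0 < `|b| - a by have := normr_ge0 b; lra.
(* This parameter is at most 1/2, and t b <= t (|b| - a) = - a / 2, so that a + t b <= a / 2 < 0. *)
have t01 : 0 < - a / (2 * (`|b| - a)) <= 1.
  apply/andP; split; first by apply: divr_gt0; lra.
  by rewrite ler_pdivrMr; have := normr_ge0 b; lra.
have := h _ t01; apply/negP; rewrite -ltNge.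
have bd : b <= `|b| - a by have := ler_norm b; lra.
apply: (@le_lt_trans _ _ (a + - a / (2 * (`|b| - a)) * (`|b| - a))).
  by rewrite lerD2l ler_wpM2l //; case/andP: t01 => /ltW.
rewrite invfM mulrA mulfVK ?gt_eqF //; lra.
Qed.

Lemma segmentE (R : pzRingType) (V : lmodType R) (v w : V) (t : R) :
  t *: w + (1 - t) *: v = v + t *: (w - v).
Proof. by rewrite scalerBl scale1r scalerBr addrCA. Qed.

(** Minimality tested at the point of parameter [t] on the segment, with convexity of [f], gives 0
    <= t (f w - f v + a) + t^2 k; divide by [t] and let it tend to 0. *)
Lemma convex_min_variational (R : realType) (V : normedModType R)
    (f : V -> \bar R) (phi : V -> R) (v w : V) (a k : R) :
  econvex f -> f v \is a fin_num -> f w \is a fin_num ->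
  (forall t, phi (t *: w + (1 - t) *: v) = phi v + t * a + t ^+ 2 * k) ->
  (forall z, (f v + (phi v)%:E <= f z + (phi z)%:E)%E) ->
  0 <= fine (f w) - fine (f v) + a.
Proof.
move=> cf fv fw phiE vmin; apply: (@affine_ge0_at0 _ _ k) => t /andP[t0 t1].
have t01 : 0 <= t <= 1 by rewrite ltW.
have := le_trans (vmin (t *: w + (1 - t) *: v)) (leeD (cf w v t t01) (lexx _)).
rewrite phiE -(fineK fv) -(fineK fw) -!EFinM -!EFinD lee_fin /= => h.
by rewrite -(pmulr_rge0 _ t0); lra.
Qed.

(** * Inner product identities behind the step estimates *)

Section InnerProduct.
Context {R : realType} {V : completeNormedModType R}.
Context (ip : {dot V for idfun}) (hV : induces_norm ip).

Lemma dotC u v : ip u v = ip v u.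
Proof. by rewrite hermC expr0 mul1r. Qed.

Lemma dotZl a u v : ip (a *: u) v = a * ip u v.
Proof. exact: linearZl_LR. Qed.

Lemma dotZr a u v : ip u (a *: v) = a * ip u v.
Proof. exact: linearZr_LR. Qed.

Lemma dotDl u v w : ip (u + v) w = ip u w + ip v w.
Proof. exact: linearDl. Qed.

Lemma dotDr u v w : ip u (v + w) = ip u v + ip u w.
Proof. exact: linearDr. Qed.

Lemma dotNl u v : ip (- u) v = - ip u v.
Proof. exact: linearNl. Qed.

Lemma dotNr u v : ip u (- v) = - ip u v.
Proof. exact: linearNr. Qed.

Definition dotE := (dotDl, dotNl, dotZl, dotDr, dotNr, dotZr).

Lemma dot_CauchySchwarz u v : ip u v <= `|u| * `|v|.
Proof.
have [->|u0] := eqVneq u 0; first by rewrite linear0l normr0 mul0r.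
have [->|v0] := eqVneq v 0; first by rewrite linear0r normr0 mulr0.
have uv_gt0 : 0 < `|u| * `|v| by rewrite mulr_gt0 ?normr_gt0.
have := sqr_ge0 `| `|v| *: u - `|u| *: v|.
rewrite hV !dotE -!hV (dotC v u) => h.
rewrite -subr_ge0 -(pmulr_rge0 _ uv_gt0); lra.
Qed.

Lemma norm_sub_sqr u v :
  `|u - v| ^+ 2 = `|u| ^+ 2 + `|v| ^+ 2 - 2 * ip u v.
Proof. by rewrite !hV !dotE (dotC v u); ring. Qed.

(** Supplies the expansion required by [convex_min_variational]: the slope pairs [d] with the
    multiplier updated by [tau *: z]. *)
Lemma aug_term_quadratic (lam z d : V) (tau t : R) :
  ip lam (z + t *: d) + tau / 2 * `|z + t *: d| ^+ 2
  = ip lam z + tau / 2 * `|z| ^+ 2 + t * ip (lam + tau *: z) d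
    + t ^+ 2 * (tau / 2 * `|d| ^+ 2).
Proof. by rewrite !hV !dotE (dotC d z); field. Qed.

(** With E = D - s, adding twice the monotonicity hypothesis to |E - theta D' + t|^2 >= 0 cancels
    every mixed product and leaves |E|^2 <= theta^2 |D'|^2 + |t|^2. *)
Lemma monotone_step_bound (D D' s t : V) (theta : R) :
  0 <= theta <= 1 ->
  0 <= ip (D - s + t) (theta *: D' - (D - s)) ->
  `|D - s| ^+ 2 <= `|D'| ^+ 2 + `|t| ^+ 2.
Proof.
move=> /andP[th0 th1]; move: (D - s) => E mono.
have := sqr_ge0 `|E - theta *: D' + t|; rewrite !hV => sq.
have D'_ge0 : 0 <= (1 - theta ^+ 2) * ip D' D'.
  by rewrite mulr_ge0 -?hV ?sqr_ge0 // subr_ge0 expr_le1.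
move: mono sq; rewrite !dotE (dotC D' E) (dotC t E) (dotC D' t); lra.
Qed.

End InnerProduct.

(** * Optimality conditions of the two minimization steps *)

Section AdmmSteps.
Context {R : realType} {X Y : completeNormedModType R}.
Context (ipX : {dot X for idfun}) (ipY : {dot Y for idfun}).
Context (hX : induces_norm ipX) (hY : induces_norm ipY).
Context (F : Y -> \bar R) (G : X -> \bar R).
Context (F_convex : econvex F) (F_proper : eproper F) (G_convex : econvex G).
Context (G_fin : forall v, G v \is a fin_num).
Context (B : {linear X -> Y}) (tau : R) (u : X) (p lam : Y).

Let L v q := lagrangian ipY F G B tau v q lam.

Lemma p_step_fin : (forall q, (L u p <= L u q)%E) -> F p \is a fin_num.
Proof.
move=> pmin; have [F_noo [q Fq]] := F_proper.
have Gu := G_fin u; have := pmin q; rewrite /L /lagrangian.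
rewrite fin_numE F_noo /=; apply: contraL => /eqP ->.
have Fq_fin : F q \is a fin_num by rewrite fin_numE F_noo /= lt_eqF.
by rewrite -(fineK Gu) -(fineK Fq_fin).
Qed.

(** In the algorithm [u] is still the old iterate here, so the subgradient is the new multiplier
    minus [s], not the new multiplier itself. *)
Lemma p_step_subgradient : (forall q, (L u p <= L u q)%E) ->
  forall q, F q \is a fin_num ->
  ipY (lam + tau *: (B u - p)) (q - p) <= fine (F q) - fine (F p).
Proof.
move=> pmin q Fq; have Fp := p_step_fin pmin; have Gu := G_fin u.
rewrite -subr_ge0 -dotNr.
apply: (@convex_min_variational _ _ F (fun q => fine (G u)
  + (ipY lam (B u - q) + tau / 2 * `|B u - q| ^+ 2)) _ _ _
  (tau / 2 * `|- (q - p)| ^+ 2)) => //.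
- move=> t; have -> : B u - (t *: q + (1 - t) *: p) = B u - p + t *: (- (q - p)).
    by rewrite segmentE opprD addrA scalerN.
  by rewrite (aug_term_quadratic hY); ring.
- by move=> z; have := pmin z; rewrite /L /lagrangian -{1 2}(fineK Gu) -!addeA -!EFinD.
Qed.

Lemma u_step_variational : F p \is a fin_num ->
  (forall v, (L u p <= L v p)%E) ->
  forall w, 0 <= fine (G w) - fine (G u)
    + ipY (lam + tau *: (B u - p)) (B (w - u)).
Proof.
move=> Fp umin w.
apply: (@convex_min_variational _ _ G (fun v => fine (F p)
  + (ipY lam (B v - p) + tau / 2 * `|B v - p| ^+ 2)) _ _ _
  (tau / 2 * `|B (w - u)| ^+ 2)) => //.
- move=> t; have -> : B (t *: w + (1 - t) *: u) - p = B u - p + t *: B (w - u).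
    by rewrite segmentE linearD linearZ addrAC.
  by rewrite (aug_term_quadratic hY); ring.
- move=> z; have := umin z; rewrite /L /lagrangian -(fineK Fp).
  by rewrite ![((fine (F p))%:E + _)%E]addeC -!addeA -!EFinD.
Qed.

Context (B' : Y -> X) (B'_adjoint : is_adjoint ipX ipY B B').
Context (gradG : X -> X) (LG : R) (gradG_lipschitz : LG.-lipschitz gradG).
Context (alphaG : R) (alphaG_gt0 : 0 < alphaG).
Context (G_strong : strongly_convex ipX G gradG alphaG).

Lemma gradG_lipschitzP v w : `|gradG v - gradG w| <= LG * `|v - w|.
Proof. exact: (gradG_lipschitz (conj I I : (setT `*` setT)%classic (v, w))). Qed.

Lemma strongly_convexP v w :
  ipX (gradG v) (w - v) + fine (G v) + alphaG * `|w - v| ^+ 2 <= fine (G w).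
Proof.
by have := G_strong v w; rewrite -(fineK (G_fin v)) -(fineK (G_fin w)).
Qed.

Lemma gradG_strongly_monotone v w :
  2 * alphaG * `|w - v| ^+ 2 <= ipX (gradG w - gradG v) (w - v).
Proof.
have := strongly_convexP v w; have := strongly_convexP w v.
by rewrite distrC -(opprB w v) !dotE; lra.
Qed.

(* A gradient inequality at the perturbed points u + t h replaces the
   differentiation of G at u: only the continuity of the gradient is used. *)
Lemma u_step_gradient : F p \is a fin_num ->
  (forall v, (L u p <= L v p)%E) ->
  gradG u = - B' (lam + tau *: (B u - p)).
Proof.
move=> Fp umin; set mu := lam + _; apply/eqP; rewrite -subr_eq0 opprK.
set h := gradG u + B' mu.
suff : `|h| ^+ 2 <= 0 by rewrite exprn_even_le0 //= normr_eq0.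
(* Moving by - t h gives (grad G (w) + B' mu, h) <= 0; replacing grad G (w) by grad G (u) costs at
   most t LG |h|^2, whence this slope. *)
rewrite -oppr_ge0; apply: (@affine_ge0_at0 _ _ (LG * `|h| ^+ 2)).
move=> t /andP[t_gt0 t_le1].
set w := u - t *: h; have wu : w - u = - (t *: h) by rewrite /w addrC addKr.
have := u_step_variational Fp umin w; rewrite -/mu -B'_adjoint wu => opt.
have := strongly_convexP w u; rewrite -(opprB w u) wu opprK normrZ => sc.
have sq_ge0 : 0 <= alphaG * (`|t| * `|h|) ^+ 2.
  by rewrite mulr_ge0 ?sqr_ge0 ?ltW.
have : 0 <= - ipX (gradG w + B' mu) (t *: h).
  by move: opt sc; rewrite !dotE; lra.
rewrite dotZr -mulrN pmulr_rge0 // => var.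
have lip : `|gradG w - gradG u| <= LG * (t * `|h|).
  by have := gradG_lipschitzP w u; rewrite wu normrN normrZ gtr0_norm.
have cs : - ipX (gradG w - gradG u) h <= `|gradG w - gradG u| * `|h|.
  by rewrite -dotNl -(normrN (gradG w - _)) dot_CauchySchwarz.
have := ler_wpM2r (normr_ge0 h) lip.
have : `|h| ^+ 2 = ipX (gradG u) h + ipX (B' mu) h by rewrite hX dotDl.
move: var cs; rewrite !dotE; lra.
Qed.

End AdmmSteps.

(** [B'] is given as a bare function; its additivity comes from testing the adjoint identity against
    the defect itself. *)
Lemma adjointB (R : realType) (X Y : completeNormedModType R)
    (ipX : {dot X for idfun}) (ipY : {dot Y for idfun})
    (hX : induces_norm ipX) (B : X -> Y) (B' : Y -> X) :
  is_adjoint ipX ipY B B' -> {morph B' : x y / x - y}.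
Proof.
move=> adj x y; apply/eqP; rewrite -subr_eq0 -normr_eq0 -sqrf_eq0 hX.
by rewrite !dotDl !dotNl dotDl dotNl !adj dotDl dotNl subrr.
Qed.

(** * Contraction of the residuals *)

Theorem proposition3p15 (R : realType) (X Y : completeNormedModType R)
  (ipX : {dot X for idfun}) (ipY : {dot Y for idfun})
  (hX : induces_norm ipX) (hY : induces_norm ipY)
  (F : Y -> \bar R) (G : X -> \bar R)
  (F_convex : econvex F) (F_proper : eproper F)
  (F_lsc : lower_semicontinuous F)
  (G_convex : econvex G) (G_proper : eproper G)
  (G_lsc : lower_semicontinuous G)
  (B : {linear X -> Y}) (B_bounded : bounded_operator B)
  (B' : Y -> X) (B'_adjoint : is_adjoint ipX ipY B B')
  (FBG_proper : eproper (fun u => F (B u) + G u)%E)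
  (FBG_coercive : coercive (fun u => F (B u) + G u)%E)
  (saddle_exists : exists (tau0 : R) (u : X) (p lam : Y),
     0 < tau0 /\ saddle_point ipY F G B tau0 u p lam)
  (G_diff : frechet_differentiable G)
  (gradG : X -> X) (gradG_grad : is_gradient ipX G gradG)
  (LG : R) (LG_gt0 : 0 < LG) (gradG_lipschitz : LG.-lipschitz gradG)
  (alphaG : R) (alphaG_gt0 : 0 < alphaG)
  (G_strong : strongly_convex ipX G gradG alphaG)
  (alphaB : R) (alphaB_gt0 : 0 < alphaB)
  (B'_below : forall mu : Y, alphaB * `|mu| <= `|B' mu|)
  (taumin taumax : R)
  (u : nat -> X) (p lam : nat -> Y) (tau : nat -> R)
  (iterates : generalized_admm ipY F G B taumin taumax u p lam tau)
  (tau_monotone : forall j : nat,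
     taumin <= tau j.+1 /\ tau j.+1 <= tau j /\ tau j <= taumax) :
  exists (gamma_ : nat -> R) (gamma : R),
    [/\ forall j : nat, 0 < gamma_ j < 1,
        gamma < 1,
        forall j : nat, (1 <= j)%N -> gamma_ j <= gamma
      & forall j : nat, (1 <= j)%N ->
          residual B u lam tau j.+1 ^+ 2
            <= gamma_ j.+1 * residual B u lam tau j ^+ 2].
Proof.
case: iterates => taumin_gt0 _ _ _ _ pmin umin lamE _.
have [C B_le] := B_bounded.
have G_fin v : G v \is a fin_num by case: (G_diff v).
have Fp_fin j : F (p j.+1) \is a fin_num.
  exact: (p_step_fin F_proper G_fin (pmin j)).
have gradE j : gradG (u j.+1) = - B' (lam j.+1).
  rewrite lamE; apply: (u_step_gradient hX hY G_convex G_fin B'_adjoint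
    gradG_lipschitz alphaG_gt0 G_strong (Fp_fin j)); exact: umin.
have subgrad j := p_step_subgradient hY F_convex F_proper G_fin (pmin j).
(* [K] bounds |D|^2 + |s|^2 by the squared increment of [u], [m] is the gain from strong convexity,
   and kappa = m / K. *)
set K := (LG / alphaB) ^+ 2 + (taumax * C) ^+ 2.
set m := 4 * taumin * alphaG.
have K_gt0 : 0 < K.
  by rewrite ltr_wpDr ?sqr_ge0 // exprn_gt0 // divr_gt0.
have m_gt0 : 0 < m by rewrite !mulr_gt0.
have Km_gt0 : 0 < K + m by rewrite addr_gt0.
exists (fun=> K / (K + m)), (K / (K + m)).
have gamma_lt1 : K / (K + m) < 1 by rewrite ltr_pdivrMr // mul1r ltrDl.
(* After the shift the residuals are those of [j.+2] and [j.+1]: [u j] and [lam j] may be the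
   initial values, while [p] occurs only from index 1 on. *)
split=> // [j|[//|j] _]; first by rewrite gamma_lt1 divr_gt0.
rewrite /residual /= !sqr_sqrtr ?addr_ge0 ?sqr_ge0
  ?(mulr_ge0 (sqr_ge0 _) (sqr_ge0 _)) //.
have [tau_min [tau_dec tau_max]] := tau_monotone j.+1.
have tau_gt0 : 0 < tau j.+2 by exact: lt_le_trans tau_min.
have tau'_gt0 : 0 < tau j.+1 by exact: lt_le_trans tau_dec.
set D := lam j.+2 - lam j.+1; set D' := lam j.+1 - lam j.
set du := u j.+2 - u j.+1.
set s := tau j.+2 *: B du; set t := tau j.+1 *: B (u j.+1 - u j).
have norm_s : `|s| ^+ 2 = tau j.+2 ^+ 2 * `|B du| ^+ 2.
  by rewrite normrZ exprMn gtr0_norm.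
have norm_t : `|t| ^+ 2 = tau j.+1 ^+ 2 * `|B (u j.+1 - u j)| ^+ 2.
  by rewrite normrZ exprMn gtr0_norm.
have DsE : D - s = tau j.+2 *: (B (u j.+1) - p j.+2).
  rewrite /D /s /du (lamE j.+1) (addrC (lam _)) addrK -scalerBr [B (_ - _)]linearB.
  by rewrite opprB addrC addrA subrK.
have DtE : D' - t = tau j.+1 *: (B (u j) - p j.+1).
  rewrite /D' /t (lamE j) (addrC (lam _)) addrK -scalerBr [B (_ - _)]linearB.
  by rewrite opprB addrC addrA subrK.
have step_bound : `|D - s| ^+ 2 <= `|D'| ^+ 2 + `|t| ^+ 2.
  (* The ratio rescales D' to the new step size, so that theta D' - (D - s) is a multiple of the
     increment of [p]; it is at most 1 because the step sizes decrease. *)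
  apply: (monotone_step_bound hY (theta := tau j.+2 / tau j.+1)).
    by rewrite divr_ge0 ?(ltW tau_gt0) ?(ltW tau'_gt0) //= ler_pdivrMr // mul1r.
  have -> : D - s + t = (lam j.+1 + tau j.+2 *: (B (u j.+1) - p j.+2))
      - (lam j + tau j.+1 *: (B (u j) - p j.+1)).
    have -> : lam j.+1 = D' + lam j by rewrite subrK.
    rewrite -DsE -DtE opprD opprB addrA [X in X + (t - D')]addrAC addrK.
    by rewrite [RHS]addrC addrA subrK addrC.
  have -> : (tau j.+2 / tau j.+1) *: D' - (D - s)
      = tau j.+2 *: (p j.+2 - p j.+1).
    rewrite DsE /D' (lamE j) (addrC (lam _)) addrK scalerA mulfVK ?gt_eqF //.
    by rewrite -scalerBr opprB addrC addrA subrK.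
  rewrite dotZr mulr_ge0 ?(ltW tau_gt0) // dotDl dotNl.
  have := subgrad j _ (Fp_fin j.+1); have := subgrad j.+1 _ (Fp_fin j).
  by rewrite -(opprB (p j.+2) (p j.+1)) dotNr; lra.
have D_du : ipY D (B du) <= - (2 * alphaG * `|du| ^+ 2).
  have := gradG_strongly_monotone G_fin G_strong (u j.+1) (u j.+2).
  rewrite !gradE -/du dotDl !dotNl !B'_adjoint /D dotDl dotNl; lra.
have D_le : `|D| ^+ 2 <= (LG / alphaB) ^+ 2 * `|du| ^+ 2.
  rewrite -exprMn ler_pXn2r ?nnegrE ?mulr_ge0 ?invr_ge0 ?(ltW LG_gt0) ?(ltW alphaB_gt0) //.
  rewrite mulrAC ler_pdivlMr // mulrC (le_trans (B'_below D)) //.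
  have := gradG_lipschitzP gradG_lipschitz (u j.+2) (u j.+1).
  by rewrite !gradE -opprD normrN /D (adjointB hX B'_adjoint).
have s_le : `|s| ^+ 2 <= (taumax * C) ^+ 2 * `|du| ^+ 2.
  have Bdu : `|B du| ^+ 2 <= C ^+ 2 * `|du| ^+ 2.
    (* [C] comes without a sign; [C * |du|] is nonnegative since it bounds a norm. *)
    by rewrite -exprMn ler_pXn2r ?nnegrE ?B_le // (le_trans _ (B_le du)).
  have tau_le : tau j.+2 <= taumax by exact: le_trans tau_dec tau_max.
  rewrite norm_s exprMn -(mulrA (taumax ^+ 2)); apply: ler_pM; rewrite ?sqr_ge0 //.
  by rewrite ler_pXn2r ?nnegrE ?(ltW tau_gt0) // (le_trans (ltW tau_gt0)).
rewrite -norm_s -norm_t mulrAC ler_pdivlMr // mulrC.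
have dec : `|D| ^+ 2 + `|s| ^+ 2 + m * `|du| ^+ 2 <= `|D'| ^+ 2 + `|t| ^+ 2.
  apply: le_trans step_bound.
  (* The lower bound [taumin] makes the gain uniform in [j]. *)
  have m_le : m * `|du| ^+ 2 <= tau j.+2 * (4 * alphaG * `|du| ^+ 2).
    by rewrite /m (mulrC 4) -!mulrA ler_wpM2r // !mulr_ge0 ?sqr_ge0 ?(ltW alphaG_gt0).
  have := ler_wpM2l (ltW tau_gt0) D_du.
  by rewrite (norm_sub_sqr hY D s) [ipY D s]dotZr; lra.
have sum_le : `|D| ^+ 2 + `|s| ^+ 2 <= K * `|du| ^+ 2.
  by rewrite mulrDl lerD.
(* In K times [dec] plus m times [sum_le] the terms K m |du|^2 cancel. *)
have := ler_wpM2l (ltW m_gt0) sum_le; have := ler_wpM2l (ltW K_gt0) dec; lra.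
Qed.
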